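(* Let $G$ be a graph with $n$ vertices, maximum degree $\Delta$ and minimum degree $\delta$, and let $\overline{G}$ be its complement. If $0\leq \alpha \leq 1$ and $1\leq k\leq n$, then $$(1-\alpha)n+(\alpha n-1)k \leq S_{k}(A_{\alpha}(G))+S_{k}(A_{\alpha}(\overline{G}))\leq k\left[(2-\alpha)n+\alpha(\Delta-\delta-1)-(1-\alpha)(k+1)\right].$$
   Context: All graphs are simple and undirected. $A_{\alpha}(G)=\alpha D(G)+(1-\alpha)A(G)$, where $A(G)$ is the adjacency matrix and $D(G)$ the diagonal degree matrix. For a real symmetric matrix $M$ with eigenvalues $\lambda_1(M)\geq\cdots\geq\lambda_n(M)$, $S_k(M)=\sum_{i=1}^k\lambda_i(M)$. *)

(* Defs.v *)
From HB Require Import structures.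
From Stdlib Require Import ClassicalEpsilon.
From mathcomp Require Import all_boot all_order all_algebra.
From mathcomp Require Import reals.
Set Implicit Arguments. Unset Strict Implicit. Unset Printing Implicit Defensive.
Import Order.TTheory GRing.Theory Num.Theory.
Local Open Scope ring_scope.

Definition simple_graph (n : nat) (e : rel 'I_n) : Prop :=
  (forall i j, e i j = e j i) /\ (forall i, ~~ e i i).

Definition compl_graph (n : nat) (e : rel 'I_n) : rel 'I_n :=
  fun i j => (i != j) && ~~ e i j.

Definition deg (n : nat) (e : rel 'I_n) (i : 'I_n) : nat := #|[set j | e i j]|.

(* maximum / minimum degree (for n >= 1; the initial values n.-1 / 0 are
   neutral since every degree is at most n-1) *)
Definition maxdeg (n : nat) (e : rel 'I_n) : nat := (\max_(i < n) deg e i)%N.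
Definition mindeg (n : nat) (e : rel 'I_n) : nat := (\big[minn/n]_(i < n) deg e i)%N.

Definition adjmx (R : realType) (n : nat) (e : rel 'I_n) : 'M[R]_n :=
  \matrix_(i, j) (e i j)%:R.
Definition degmx (R : realType) (n : nat) (e : rel 'I_n) : 'M[R]_n :=
  \matrix_(i, j) ((i == j)%:R * (deg e i)%:R).

Definition Aalpha (R : realType) (n : nat) (alpha : R) (e : rel 'I_n) : 'M[R]_n :=
  alpha *: degmx R e + (1 - alpha) *: adjmx R e.

Definition is_spectrum (R : realType) (n : nat) (M : 'M[R]_n) (s : seq R) : Prop :=
  sorted (fun x y : R => y <= x) s /\
  char_poly M = \prod_(x <- s) ('X - x%:P).

(* eigenvalues lambda_1 >= ... >= lambda_n (chosen classically; unique when it exists,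
   which is the case for real symmetric matrices) *)
Definition eigs (R : realType) (n : nat) (M : 'M[R]_n) : seq R :=
  epsilon (inhabits [::]) (is_spectrum M).

Definition Sk (R : realType) (n : nat) (k : nat) (M : 'M[R]_n) : R :=
  \sum_(i < k) nth 0 (eigs M) i.

(* Main.v *)
(* For symmetric M with orthonormal eigenvectors u_l and eigenvalues s_l, let Q be
   the real part of the projection onto the span of u_1, ..., u_k, so that
   S_k(M) = sum Q_ij M_ij.

   Upper bound: tr Q = k, Q_ii >= 0 and sum Q_ij^2 <= k.  The diagonal of A_alpha
   contributes at most alpha k Delta.  Off the diagonal,
   Q_ij A_ij <= (n Q_ij^2 + 1/n) / 2, while sum Q_ii^2 >= k^2 / n; this gives
   S_k(A_alpha(G)) <= alpha k Delta + (1 - alpha) k (2n - k - 1) / 2.  Add the same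
   bound for the complement, whose maximum degree is n - 1 - delta.

   Lower bound: t_l = |<u_l, 1>|^2 / n are nonnegative weights of sum 1.  With
   c = (k - 1) / (n - 1), the weights c + (1 - c) t_l lie in [0, 1] and sum to k, so
   S_k(M) >= c tr M + (1 - c) (sum of the entries of M) / n.  The right-hand side is
   linear in M, and the two graphs add up to the complete graph. *)
Require Import Defs.
From HB Require Import structures.
From mathcomp Require Import all_boot all_order all_algebra.
From mathcomp Require Import reals.
From Stdlib Require Import ClassicalEpsilon.
From mathcomp Require Import fingroup perm spectral complex ring lra.
Set Implicit Arguments. Unset Strict Implicit. Unset Printing Implicit Defensive.
Import Order.TTheory GRing.Theory Num.Theory.
Local Open Scope ring_scope.
Local Open Scope sesquilinear_scope.

(** * Spectral decomposition of a real symmetric matrix *)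

Lemma char_poly_conj (F : fieldType) (n : nat) (P D : 'M[F]_n) :
  P \in unitmx -> char_poly (invmx P *m D *m P) = char_poly D.
Proof.
move=> uP; rewrite /char_poly /char_poly_mx.
have PV : map_mx polyC (invmx P) *m map_mx polyC P = 1%:M.
  by rewrite -map_mxM mulVmx // map_mx1.
have -> : 'X%:M - map_mx polyC (invmx P *m D *m P)
    = map_mx polyC (invmx P) *m ('X%:M - map_mx polyC D) *m map_mx polyC P.
  rewrite mulmxBr mulmxBl !map_mxM scalar_mxC.
  by rewrite -[_ *m _ *m map_mx _ P in RHS]mulmxA PV mulmx1.
by rewrite !det_mulmx mulrAC -[X in X * _]det_mulmx PV det1 mul1r.
Qed.

Lemma conj_diag_mxE (C : numClosedFieldType) (n : nat) (U : 'M[C]_n) (d : 'rV_n)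
    (i j : 'I_n) :
  (U^t* *m diag_mx d *m U) i j = \sum_l d 0 l * ((U l i)^* * U l j).
Proof.
rewrite !mxE; apply: eq_bigr => l _.
by rewrite mul_mx_diag !mxE mulrCA mulrA.
Qed.

(** The spectral theorem over [R[i]] diagonalizes [M] with real eigenvalues in some unspecified
    order. Permuting the rows of the unitary matrix puts them in the order of [eigs M], so that the
    chosen list becomes usable. *)
Lemma sym_spectral (R : realType) (n : nat) (M : 'M[R]_n) : M^T = M ->
  exists U : 'M[R[i]%C]_n,
    [/\ U \is unitarymx, size (eigs M) = n,
        sorted (fun x y : R => y <= x) (eigs M) &
        map_mx (real_complex R) M
          = U^t* *m diag_mx (\row_i ((eigs M)`_i)%:C%C) *m U].
Proof.
move=> sM; pose MC := map_mx (real_complex R) M.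
have hM : MC \is hermsymmx.
  apply: realsym_hermsym.
    by apply/is_hermitianmxP; rewrite expr0 scale1r map_mx_id // /MC map_trmx sM.
  by apply/mxOverP=> i j; rewrite mxE complex_real.
have /orthomx_spectralP MCE := hermitian_normalmx hM.
have /mxOverP rd := hermitian_spectral_diag_real hM.
set P := spectralmx MC in MCE; set d := spectral_diag MC in MCE rd.
pose r := [tuple complex.Re (d 0 i) | i < n].
have dE i : d 0 i = (tnth r i)%:C%C by rewrite tnth_mktuple RRe_real.
pose s := sort (fun x y : R => y <= x) r.
have ss : sorted (fun x y : R => y <= x) s.
  by apply: sort_sorted => x y; exact: ge_total.
have charM : char_poly M = \prod_(x <- r) ('X - x%:P).
  (* The factorization is checked over [R[i]], where [M] is similar to a diagonal matrix, and
     descends to [R] by injectivity. *)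
  apply: (@map_poly_inj _ _ (real_complex R)).
  rewrite map_char_poly -/MC MCE char_poly_conj ?spectral_unit //.
  rewrite char_poly_trig ?diag_mx_is_trig // map_prod_XsubC big_tuple.
  by apply: eq_bigr => i _; rewrite mxE eqxx mulr1n dE.
(* Sorting the eigenvalues exhibits one spectrum, which is what makes the [epsilon] choice
   meaningful. *)
have [se ce] : is_spectrum M (eigs M).
  apply: epsilon_spec; exists s; split=> //.
  by rewrite charM; apply: perm_big; rewrite perm_sym perm_sort.
(* A product of monic linear factors determines its roots up to order. *)
have pr : perm_eq (eigs M) r by apply: prod_XsubC_eq; rewrite -ce -charM.
have [p ep] := tuple_permP pr.
have En (i : 'I_n) : (eigs M)`_i = tnth r (p i).
  by rewrite ep -tnth_nth tnth_mktuple.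
exists (perm_mx p *m P); split=> //.
- apply: mul_unitarymx; last exact: spectral_unitarymx.
  by apply/unitarymxP; rewrite tr_perm_mx map_perm_mx -perm_mxM mulgV perm_mx1.
- by rewrite (perm_size pr) size_tuple.
rewrite -/MC MCE.
apply/matrixP=> i j.
rewrite invmx_unitary ?spectral_unitarymx // -row_permE !conj_diag_mxE.
rewrite (reindex_inj (@perm_inj _ p)); apply: eq_bigr => l _.
by rewrite !mxE En dE.
Qed.

(** * Sums of leading eigenvalues: projections and averaging *)

Lemma Re_sum (R : rcfType) (I : Type) (r : seq I) (P : pred I) (F : I -> R[i]%C) :
  complex.Re (\sum_(i <- r | P i) F i) = \sum_(i <- r | P i) complex.Re (F i).
Proof.
by apply: (big_morph (@complex.Re R)) => [[a b] [c d]|].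
Qed.

Lemma Re_mulr_real (R : rcfType) (z : R[i]%C) (x : R) :
  complex.Re (z * x%:C%C) = complex.Re z * x.
Proof. by case: z => a b /=; rewrite mulr0 subr0. Qed.

Lemma sqr_Re_le (R : rcfType) (z : R[i]%C) : complex.Re z ^+ 2 <= complex.Re (z * z^*).
Proof.
rewrite -normCK -add_Re2_Im2 /= lerDl; exact: sqr_ge0.
Qed.

(** Only the first [k] rows [V] of the unitary matrix enter the projection [P]. Its real part [Q]
    suffices, because [M] is real and the trace pairing with [M] sees nothing else. *)
Lemma Sk_density (R : realType) (n k : nat) (M : 'M[R]_n) :
  M^T = M -> (k <= n)%N ->
  exists Q : 'M[R]_n,
    [/\ forall i, 0 <= Q i i, \tr Q = k%:R,
        \sum_i \sum_j Q i j ^+ 2 <= k%:R &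
        Sk k M = \sum_i \sum_j Q i j * M i j].
Proof.
move=> sM kn; have [U [uU _ _ ME]] := sym_spectral sM.
pose f := widen_ord kn; pose V := rowsub f U.
have VV : V *m V^t* = 1%:M.
  apply/matrixP=> i j; have /matrixP/(_ (f i) (f j)) := unitarymxP uU.
  rewrite !mxE -val_eqE /= val_eqE => <-.
  by apply: eq_bigr => l _; rewrite !mxE.
pose P := V^t* *m V.
have PE i j : P i j = \sum_l (V l i)^* * V l j.
  by rewrite mxE; apply: eq_bigr => l _; rewrite !mxE.
have PH i j : P j i = (P i j)^*.
  rewrite !PE rmorph_sum; apply: eq_bigr => l _.
  by rewrite rmorphM /= conjCK mulrC.
have trP : complex.Re (\tr P) = k%:R.
  by rewrite mxtrace_mulC VV mxtrace1 -(rmorph_nat (real_complex R)).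
pose Q := \matrix_(i, j) complex.Re (P i j).
have QE i j : Q i j = complex.Re (P i j) by rewrite mxE.
exists Q; split.
- move=> i; rewrite QE PE Re_sum sumr_ge0 // => l _.
  by rewrite mulrC (le_trans (sqr_ge0 _) (sqr_Re_le _)).
- by rewrite -trP Re_sum; apply: eq_bigr => i _; rewrite QE.
(* Since [P] is idempotent and hermitian, its trace is the sum of the squared moduli of its entries;
   passing to real parts can only decrease that sum. *)
- rewrite -trP; have <- : P *m P = P by rewrite /P mulmxA -[_ *m V *m _]mulmxA VV mulmx1.
  rewrite Re_sum; apply: ler_sum => i _; rewrite mxE Re_sum; apply: ler_sum => j _.
  by rewrite QE (PH i j); exact: sqr_Re_le.
- pose MC := map_mx (real_complex R) M.
  have UMU : U *m MC *m U^t* = diag_mx (\row_i ((eigs M)`_i)%:C%C).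
    by rewrite /MC ME !mulmxA (unitarymxP uU) mul1mx mulmxtVK.
  have -> : \sum_i \sum_j Q i j * M i j = complex.Re (\tr (P *m MC)).
    rewrite Re_sum; apply: eq_bigr => i _; rewrite mxE Re_sum; apply: eq_bigr => j _.
    by rewrite [MC j i]mxE Re_mulr_real QE -[in RHS]sM [M^T j i]mxE.
  (* By cyclicity the trace becomes that of [V *m MC *m V^t*], whose diagonal consists of the first
     [k] eigenvalues. *)
  rewrite -mulmxA mxtrace_mulC Re_sum; apply: eq_bigr => l _.
  have -> : (V *m MC *m V^t*) l l = (U *m MC *m U^t*) (f l) (f l).
    rewrite !mxE; apply: eq_bigr => j _; rewrite !mxE; congr (_ * _).
    by apply: eq_bigr => i _; rewrite !mxE.
  by rewrite UMU !mxE eqxx.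
Qed.

(** The indicator [h] of the first [k] indices and [w] have the same total, so a threshold [t] may
    be subtracted from every entry of [s]. With [t] the [k]-th largest entry, [h i - w i] and the
    shifted entry never have opposite signs. *)
Lemma weighted_sum_le_top (R : realDomainType) (n k : nat) (s : seq R) (w : 'I_n -> R) :
  size s = n -> sorted (fun x y : R => y <= x) s -> (k <= n)%N ->
  (forall i, 0 <= w i <= 1) -> \sum_i w i = k%:R ->
  \sum_i w i * s`_i <= \sum_(i < k) s`_i.
Proof.
move=> ss srt kn w01 sw.
have mono i j : (i <= j < n)%N -> s`_j <= s`_i.
  move=> /andP[ij jn].
  apply: (@sorted_leq_nth _ (fun x y : R => y <= x)) => //.
  - by move=> y x z xy yz; exact: le_trans yz xy.
  - by rewrite inE ss (leq_ltn_trans ij jn).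
  - by rewrite inE ss.
(* For [k = 0] the index is 0; then only indices with [k <= i] occur, and the first entry still
   dominates them. *)
pose t := s`_k.-1; pose h (i : 'I_n) : R := (i < k)%:R.
have hE (F : nat -> R) : \sum_(i < k) F i = \sum_(i < n) h i * F i.
  rewrite (big_ord_widen n F kn) big_mkcond /=; apply: eq_bigr => i _.
  by rewrite /h; case: ifP; rewrite ?mul1r ?mul0r.
have sh : \sum_i h i = k%:R.
  rewrite -[k in RHS]card_ord -sumr_const (hE (fun=> 1)).
  by apply: eq_bigr => i _; rewrite mulr1.
rewrite hE -subr_ge0 -sumrB.
have -> : \sum_i (h i * s`_i - w i * s`_i) = \sum_i (h i - w i) * (s`_i - t).
  under [RHS]eq_bigr do rewrite mulrBr mulrBl.
  by rewrite [RHS]sumrB -mulr_suml [\sum_i (h i - w i)]sumrB sh sw subrr mul0r subr0.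
apply: sumr_ge0 => i _; have /andP[w0 w1] := w01 i; rewrite /h.
case: ltnP => ik.
  rewrite mulr_ge0 ?subr_ge0 // mono //.
  by case: (k) ik kn => // k' ik kn; rewrite -ltnS ik.
by rewrite mulr_le0 ?sub0r ?oppr_le0 ?subr_le0 // mono // (leq_trans (leq_pred _) ik) /=.
Qed.

(** The equation on [c] says that the weights [c + (1 - c) * t l] have sum [k]; written without a
    quotient, it also makes sense for [n = 1]. *)
Lemma Sk_ge_ones (R : realType) (n k : nat) (M : 'M[R]_n) (c : R) :
  M^T = M -> (k <= n)%N -> 0 <= c <= 1 -> c * n%:R + (1 - c) = k%:R -> (0 < n)%N ->
  c * \tr M + (1 - c) * ((\sum_i \sum_j M i j) / n%:R) <= Sk k M.
Proof.
move=> sM kn /andP[c0 c1] ck n0.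
have n0' : (n%:R : R) != 0 by rewrite pnatr_eq0 -lt0n.
have [U [uU sz srt ME]] := sym_spectral sM.
have UU : U^t* *m U = 1%:M by apply: mulmx1C; exact: unitarymxP.
pose x l := \sum_j U l j; pose t l := complex.Re (x l * (x l)^*) / n%:R.
(* A general diagonal [d] serves twice: [d = 1] yields that the weights [t] have sum 1, and [d] the
   eigenvalues yields the entry sum of [M]. *)
have sum_entries (d : 'I_n -> R) :
    complex.Re (\sum_i \sum_j (U^t* *m diag_mx (\row_l (d l)%:C%C) *m U) i j)
      = \sum_l d l * (t l * n%:R).
  under eq_bigr do under eq_bigr do rewrite conj_diag_mxE.
  under eq_bigr do rewrite exchange_big /=.
  rewrite exchange_big Re_sum /=; apply: eq_bigr => l _.
  rewrite /t divfK // [RHS]mulrC -Re_mulr_real; congr complex.Re.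
  have -> : x l * (x l)^* = \sum_i \sum_j (U l i)^* * U l j.
    by rewrite rmorph_sum mulrC mulr_suml; apply: eq_bigr => i _; rewrite mulr_sumr.
  rewrite [RHS]mulrC mulr_sumr; apply: eq_bigr => i _.
  by rewrite mulr_sumr; apply: eq_bigr => j _; rewrite mxE.
have st : \sum_l t l = 1.
  have := sum_entries (fun=> 1).
  under [in RHS]eq_bigr do rewrite mul1r.
  have -> : diag_mx (\row__ 1%:C%C) = 1%:M :> 'M[R[i]%C]_n.
    by apply/matrixP=> i j; rewrite !mxE.
  rewrite mulmx1 UU -mulr_suml => E; apply: (mulIf n0'); rewrite mul1r -{}E Re_sum.
  rewrite -[n in RHS]card_ord -sumr_const; apply: eq_bigr => i _.
  rewrite (bigD1 i) //= big1 ?addr0 ?mxE ?eqxx // => j ji.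
  by rewrite mxE eq_sym (negPf ji).
have t0 l : 0 <= t l.
  by rewrite divr_ge0 ?ler0n // (le_trans (sqr_ge0 _) (sqr_Re_le _)).
have t1 l : t l <= 1 by rewrite -st (bigD1 l) //= lerDl sumr_ge0.
have sM1 : (\sum_i \sum_j M i j) / n%:R = \sum_l t l * (eigs M)`_l.
  apply: (mulIf n0'); rewrite divfK // mulr_suml.
  under [RHS]eq_bigr do rewrite mulrAC mulrC.
  rewrite -sum_entries -ME Re_sum; apply: eq_bigr => i _.
  by rewrite Re_sum; apply: eq_bigr => j _; rewrite mxE.
have trM : \tr M = \sum_(l < n) (eigs M)`_l.
  have /(congr1 mxtrace) := ME; rewrite -mulmxA mxtrace_mulC -mulmxA.
  rewrite (unitarymxP uU) mulmx1 mxtrace_diag => /(congr1 (@complex.Re R)).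
  rewrite !Re_sum => E; transitivity (\sum_i complex.Re (map_mx (real_complex R) M i i)).
    by apply: eq_bigr => i _; rewrite mxE.
  by rewrite E; apply: eq_bigr => i _; rewrite mxE.
rewrite sM1 trM !mulr_sumr -big_split /=.
under eq_bigr do rewrite mulrA -mulrDl.
apply: weighted_sum_le_top => // [i|].
  have := t0 i; have := t1 i; nra.
by rewrite big_split /= -mulr_sumr st sumr_const card_ord -[c *+ n]mulr_natr mulr1.
Qed.

(** * Degrees, complements, trace and entry sum of [Aalpha] *)

Lemma deg_sum (R : realType) (n : nat) (e : rel 'I_n) i :
  \sum_j (e i j)%:R = (deg e i)%:R :> R.
Proof.
rewrite -natr_sum /deg -sum1dep_card [in RHS]big_mkcond.
by congr _%:R; apply: eq_bigr => j _; case: (e i j).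
Qed.

Lemma compl_simple (n : nat) (e : rel 'I_n) :
  simple_graph e -> simple_graph (compl_graph e).
Proof.
by case=> es _; split=> [i j|i]; rewrite /compl_graph ?eqxx // eq_sym es.
Qed.

Lemma deg_compl (R : realType) (n : nat) (e : rel 'I_n) i : simple_graph e ->
  (deg (compl_graph e) i)%:R = n%:R - 1 - (deg e i)%:R :> R.
Proof.
(* The [n] vertices split into [i], its neighbours and its other non-neighbours. *)
move=> [_ ei]; suff -> : n%:R = 1 + (deg e i)%:R + (deg (compl_graph e) i)%:R :> R by ring.
have -> : n%:R = \sum_(j < n) 1 :> R by rewrite sumr_const card_ord.
have -> : 1 + (deg e i)%:R = \sum_j (i == j)%:R + (deg e i)%:R :> R.
  congr (_ + _).
  by rewrite (bigD1 i) //= eqxx big1 ?addr0 // => j /negPf; rewrite eq_sym => ->.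
rewrite -!deg_sum -!big_split /=.
apply: eq_bigr => j _; rewrite /compl_graph; case: eqP => [<-|_].
  by rewrite (negPf (ei i)) !addr0.
by case: (e i j); rewrite ?addr0 ?add0r.
Qed.

Lemma mindeg_le (n : nat) (e : rel 'I_n) i : (mindeg e <= deg e i)%N.
Proof.
rewrite /mindeg; elim: (index_enum _) (mem_index_enum i) => // j r IH.
rewrite big_cons inE geq_min => /predU1P[->|/IH ->]; first by rewrite leqnn.
by rewrite orbT.
Qed.

Lemma Aalpha_sym (R : realType) (n : nat) (a : R) (e : rel 'I_n) :
  simple_graph e -> (Aalpha a e)^T = Aalpha a e.
Proof.
case=> es _; apply/matrixP=> i j; rewrite !mxE es eq_sym.
by case: eqP => [->//|]; rewrite !mul0r.
Qed.

Lemma Aalpha_tr (R : realType) (n : nat) (a : R) (e : rel 'I_n) :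
  simple_graph e -> \tr (Aalpha a e) = a * \sum_i (deg e i)%:R.
Proof.
case=> _ ei; rewrite mulr_sumr; apply: eq_bigr => i _.
by rewrite !mxE eqxx (negPf (ei i)) mulr0 addr0 mul1r.
Qed.

Lemma Aalpha_sum (R : realType) (n : nat) (a : R) (e : rel 'I_n) :
  \sum_i \sum_j Aalpha a e i j = \sum_i (deg e i)%:R.
Proof.
apply: eq_bigr => i _; under eq_bigr do rewrite !mxE.
rewrite big_split /= -!mulr_sumr deg_sum (bigD1 i) //= big1 => [|j ji].
  by rewrite eqxx mul1r addr0 addrC -mulrDl subrK mul1r.
by rewrite eq_sym (negPf ji) mul0r.
Qed.

(** * Bounds for a graph and its complement *)

(** Any degree bound [D] is allowed, so that the same estimate applies to the graph and to its
    complement. *)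
Lemma Sk_Aalpha_le (R : realType) (n k : nat) (a D : R) (e : rel 'I_n) :
  simple_graph e -> 0 <= a <= 1 -> (0 < k <= n)%N ->
  (forall i, (deg e i)%:R <= D) ->
  Sk k (Aalpha a e) <= k%:R * (a * D + (1 - a) * (2 * n%:R - k%:R - 1) / 2).
Proof.
move=> se /andP[a0 a1] /andP[k0 kn] dD.
have [Q [Q0 trQ Q2 ->]] := Sk_density (Aalpha_sym a se) kn.
have n0 : 0 < n%:R :> R by rewrite ltr0n (leq_trans k0).
have k1 : 1 <= k%:R :> R by rewrite ler1n.
have nk : k%:R <= n%:R :> R by rewrite ler_nat.
set N : R := n%:R in n0 nk *; set K : R := k%:R in k1 nk trQ Q2 *.
have sum_cst (x : R) : \sum_(i < n) x = x * N by rewrite sumr_const card_ord mulr_natr.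
have {}trQ : \sum_i Q i i = K := trQ.
(* The off-diagonal estimate [h] is summed over all entries, and [g] corrects the diagonal. It uses
   the tangent bound [N * x ^+ 2 >= 2 * K * x - K ^+ 2 / N] at the mean value [K / N] of the
   [Q i i]. *)
pose g i := a * D * Q i i - (1 - a) / 2 * (2 * K * Q i i - K ^+ 2 / N + N^-1).
pose h i j := (1 - a) / 2 * (N * Q i j ^+ 2 + N^-1).
have amgm (x : R) (b : bool) : x * b%:R <= (N * x ^+ 2 + N^-1) / 2.
  have : 0 <= N * (x - b%:R / N) ^+ 2 by rewrite mulr_ge0 ?sqr_ge0 // ltW.
  have -> : N * (x - b%:R / N) ^+ 2 = N * x ^+ 2 - 2 * (x * b%:R) + b%:R ^+ 2 / N.
    by field; rewrite gt_eqF.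
  have : b%:R ^+ 2 / N <= N^-1 :> R.
    by case: b; rewrite ?expr1n ?expr0n ?mul1r ?mul0r // invr_ge0 ltW.
  lra.
have term i j : Q i j * Aalpha a e i j <= h i j + (i == j)%:R * g i.
  rewrite !mxE; case: eqP => [<-|_].
    rewrite (negPf (se.2 i)) mulr0 addr0 !mul1r /g /h.
    have : 0 <= (1 - a) / 2 * (N * (Q i i - K / N) ^+ 2).
      by apply: mulr_ge0; [lra | rewrite mulr_ge0 ?sqr_ge0 // ltW].
    have -> : N * (Q i i - K / N) ^+ 2 = N * Q i i ^+ 2 - 2 * K * Q i i + K ^+ 2 / N.
      by field; rewrite gt_eqF.
    have : a * Q i i * (deg e i)%:R <= a * Q i i * D by rewrite ler_wpM2l ?mulr_ge0.
    lra.
  rewrite !mul0r mulr0 add0r addr0 mulrCA /h.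
  have : 0 <= 1 - a by lra.
  move=> /ler_wpM2l /(_ _ _ (amgm (Q i j) (e i j))); lra.
have {term} /le_trans : \sum_i \sum_j Q i j * Aalpha a e i j
    <= \sum_i \sum_j (h i j + (i == j)%:R * g i).
  by apply: ler_sum => i _; apply: ler_sum.
apply.
have -> : \sum_i \sum_j (h i j + (i == j)%:R * g i)
   = (1 - a) / 2 * (N * (\sum_i \sum_j Q i j ^+ 2) + N)
     + (a * D * K - (1 - a) / 2 * (K ^+ 2 + 1)).
  have -> : a * D * K - (1 - a) / 2 * (K ^+ 2 + 1) = \sum_i g i.
    rewrite /g sumrB -!mulr_sumr.
    rewrite big_split /= sumrB -!mulr_sumr.
    rewrite trQ !sum_cst.
    by field; rewrite gt_eqF.
  have -> : N * (\sum_i \sum_j Q i j ^+ 2) + N = \sum_i \sum_j (N * Q i j ^+ 2 + N^-1).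
    under [RHS]eq_bigr do rewrite big_split /= -mulr_sumr sum_cst.
    rewrite big_split /= -mulr_sumr sum_cst.
    by field; rewrite gt_eqF.
  rewrite mulr_sumr -big_split /=; apply: eq_bigr => i _.
  rewrite mulr_sumr big_split /=; congr (_ + _).
  rewrite (bigD1 i) //= big1 ?eqxx ?mul1r ?addr0 // => j ji.
  by rewrite eq_sym (negPf ji) mul0r.
have : (1 - a) * (N * (\sum_i \sum_j Q i j ^+ 2)) <= (1 - a) * (N * K).
  by rewrite ler_wpM2l ?subr_ge0 // ler_wpM2l // ltW.
(* Half of this product is exactly the slack left between the estimate and the claimed bound. *)
have : 0 <= (1 - a) * ((N - 1) * (K - 1)).
  rewrite !mulr_ge0 ?subr_ge0 //; exact: le_trans k1 nk.
lra.
Qed.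

Theorem theorem6p1 (R : realType) (n : nat) (e : rel 'I_n) (alpha : R) (k : nat) :
  simple_graph e ->
  0 <= alpha <= 1 ->
  (1 <= k <= n)%N ->
  (1 - alpha) * n%:R + (alpha * n%:R - 1) * k%:R
    <= Sk k (Aalpha alpha e) + Sk k (Aalpha alpha (compl_graph e))
  /\
  Sk k (Aalpha alpha e) + Sk k (Aalpha alpha (compl_graph e))
    <= k%:R * ((2 - alpha) * n%:R
               + alpha * ((maxdeg e)%:R - (mindeg e)%:R - 1)
               - (1 - alpha) * (k%:R + 1)).
Proof.
move=> se a01 kn; have [k0 kn'] := andP kn; have sc := compl_simple se.
have n0 : (0 < n)%N by exact: leq_trans kn'.
have n0R : (n%:R : R) != 0 by rewrite pnatr_eq0 -lt0n.
have k1R : 1 <= k%:R :> R by rewrite ler1n.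
have knR : k%:R <= n%:R :> R by rewrite ler_nat.
split; last first.
  have up : forall i, (deg e i)%:R <= (maxdeg e)%:R :> R.
    by move=> i; rewrite ler_nat /maxdeg; exact: leq_bigmax.
  have upc : forall i, (deg (compl_graph e) i)%:R <= n%:R - 1 - (mindeg e)%:R :> R.
    by move=> i; rewrite deg_compl // lerD2l lerN2 ler_nat mindeg_le.
  (* With degree bounds [maxdeg e] and [n - 1 - mindeg e], the two estimates add up to exactly the
     stated right-hand side. *)
  apply: le_trans (lerD (Sk_Aalpha_le se a01 kn up) (Sk_Aalpha_le sc a01 kn upc)) _.
  by rewrite le_eqVlt; apply/orP; left; apply/eqP; field.
pose c : R := (k%:R - 1) / (n%:R - 1).
have [c01 ck] : 0 <= c <= 1 /\ c * n%:R + (1 - c) = k%:R.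
  (* For [n = 1] the quotient has denominator 0, so [c] is 0 by convention; the equation then only
     asks for [k = 1]. *)
  have [n1|n1] := eqVneq (n%:R : R) 1.
    rewrite /c n1 subrr invr0 mulr0 lexx ler01; split=> //; lra.
  have n1' : 0 < n%:R - 1 :> R by rewrite subr_gt0 lt_def n1; exact: le_trans knR.
  split.
    by rewrite divr_ge0 ?ler_pdivrMr ?mul1r ?lerD2r ?knR ?subr_ge0 // ltW // -subr_gt0.
  by rewrite /c; field; rewrite gt_eqF.
have := lerD (Sk_ge_ones (Aalpha_sym alpha se) kn' c01 ck n0)
             (Sk_ge_ones (Aalpha_sym alpha sc) kn' c01 ck n0).
apply: le_trans; rewrite !Aalpha_tr // !Aalpha_sum.
have -> : \sum_i (deg (compl_graph e) i)%:R = n%:R * (n%:R - 1) - \sum_i (deg e i)%:R :> R.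
  rewrite (eq_bigr (fun i => n%:R - 1 - (deg e i)%:R)) => [|i _]; last exact: deg_compl.
  by rewrite sumrB sumr_const card_ord -[(_ - 1) *+ n]mulr_natl.
(* The degree sums cancel: after substituting [k = c * n + (1 - c)], both sides equal [c * alpha * n
   * (n - 1) + (1 - c) * (n - 1)]. *)
rewrite le_eqVlt; apply/orP; left; apply/eqP.
by rewrite -ck; field.
Qed.
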